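(* Let $X$ be a non-singular projective hyperelliptic curve of genus $g\ge 3$ over $\mathbf{C}$. If $(\mu,\lambda)\in BGN\cup M$ and $1\le s\le g$ ($s$ an integer), then $T_{2s-2,s}(\mu,\lambda)$ is $n$-BN for all positive integers $n$ such that $(\mu,\lambda)$ is $n$-BN.
   Context: For integers $n\ge1$, $k$, $d$, the Brill-Noether locus $\mathcal{W}^{k-1}_{n,d}$ is the set of stable vector bundles $E$ of rank $n$ and degree $d$ on $X$ (points of the moduli space $\mathcal{M}(n,d)$ of stable bundles) with $h^0(E)\ge k$. A point $(\mu,\lambda)\in\mathbf{Q}^2$ is called $n$-BN if $d=n\mu$ and $k=n\lambda$ are both integers and $\mathcal{W}^{k-1}_{n,d}\ne\emptyset$. Regions: $BGN=\{(\mu,\lambda): 0<\mu\le 1,\ 0<\lambda\le\frac1g(\mu+g-1)\}\setminus\{(1,1)\}$, $M=\{(\mu,\lambda): 1<\mu<2,\ 0<\lambda\le\frac1g(\mu+g-1)\}\cup\{(2,\lambda): 0<\lambda<1\}$. For integers $d',s$, $T_{d',s}$ is the affine map $T_{d',s}(\mu,\lambda)=(\mu+d',s\lambda)$. Curves are irreducible and complete. *)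

(* Defs.v *)
From HB Require Import structures.
From mathcomp Require Import all_boot all_order all_algebra.
From mathcomp Require Import mpoly complex.
From mathcomp Require Import boolp classical_sets cardinality fsbigop reals.

Set Implicit Arguments.
Unset Strict Implicit.
Unset Printing Implicit Defensive.

Import Order.TTheory GRing.Theory Num.Theory.

Local Open Scope classical_set_scope.
Local Open Scope ring_scope.

(** * Projective space and the Zariski topology

    The ground field is [R[i]] for [R : realType].  A point of P^N is a line
    through the origin of [R[i]^(N+1)]. *)

Definition proj (R : realType) (N : nat) : Type :=
  {L : {vspace 'rV[R[i]]_N.+1} | \dim L == 1%N}.

Definition vanishes (R : realType) (N : nat) (p : {mpoly R[i][N.+1]})
    (P : proj R N) : Prop :=
  forall v : 'rV[R[i]]_N.+1, v \in val P -> p.@[v 0] = 0.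

Definition zclosed (R : realType) (N : nat) (Z : set (proj R N)) : Prop :=
  exists S : set {mpoly R[i][N.+1]},
    (forall p, S p -> exists m : nat, p \is m.-homog) /\
    Z = [set P | forall p, S p -> vanishes p P].

(** Open subsets of [X] for the topology induced on [X]. *)
Definition zopen (R : realType) (N : nat) (X U : set (proj R N)) : Prop :=
  exists2 Z : set (proj R N), zclosed Z & U = X `\` Z.

Definition zirreducible (R : realType) (N : nat) (Y : set (proj R N)) : Prop :=
  Y !=set0 /\
  forall A B : set (proj R N), zclosed A -> zclosed B ->
    Y `<=` A `|` B -> Y `<=` A \/ Y `<=` B.

(** A chain [Y_0 < ... < Y_m] of irreducible closed subsets of [X]; the
    dimension of [X] is the largest such [m]. *)
Definition irr_chain (R : realType) (N : nat) (X : set (proj R N)) (m : nat)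
    (Y : nat -> set (proj R N)) : Prop :=
  (forall i, (i <= m)%N -> [/\ zclosed (Y i), zirreducible (Y i) & Y i `<=` X])
  /\ (forall i, (i < m)%N -> Y i `<` Y i.+1).

Definition has_dim (R : realType) (N : nat) (X : set (proj R N)) (m : nat) :
    Prop :=
  (exists Y, irr_chain X m Y) /\ ~ (exists Y, irr_chain X m.+1 Y).

(** * Regular functions

    Functions are total on P^N; only their values on the relevant open subset
    of [X] are meaningful. *)

Definition regular_at (R : realType) (N : nat) (X : set (proj R N))
    (P : proj R N) (f : proj R N -> R[i]) : Prop :=
  exists (U : set (proj R N)) (m : nat) (p q : {mpoly R[i][N.+1]}),
    [/\ zopen X U, U P, p \is m.-homog, q \is m.-homog &
     forall Q, U Q -> forall v : 'rV[R[i]]_N.+1, v \in val Q -> v != 0 ->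
       q.@[v 0] != 0 /\ f Q = p.@[v 0] / q.@[v 0]].

Definition regular_on (R : realType) (N : nat) (X U : set (proj R N))
    (f : proj R N -> R[i]) : Prop :=
  forall P, U P -> regular_at X P f.

Definition mx_regular_on (R : realType) (N : nat) (X U : set (proj R N))
    (m n : nat) (A : proj R N -> 'M[R[i]]_(m, n)) : Prop :=
  forall i j, regular_on X U (fun P => A P i j).

Definition germ_eq (R : realType) (N : nat) (X : set (proj R N))
    (P : proj R N) (f g : proj R N -> R[i]) : Prop :=
  exists U, [/\ zopen X U, U P & forall Q, U Q -> f Q = g Q].

(** [t] generates the maximal ideal of the local ring of [X] at [P]. *)
Definition local_parameter (R : realType) (N : nat) (X : set (proj R N))
    (P : proj R N) (t : proj R N -> R[i]) : Prop :=
  [/\ regular_at X P t, t P = 0 &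
   forall f, regular_at X P f -> f P = 0 ->
     exists2 a, regular_at X P a & germ_eq X P f (fun Q => a Q * t Q)].

(** Regularity of the one-dimensional local rings: the maximal ideal is
    generated by one element. *)
Definition nonsingular_projective_curve (R : realType) (N : nat)
    (X : set (proj R N)) : Prop :=
  [/\ zclosed X, zirreducible X, has_dim X 1 &
   forall P, X P -> exists t, local_parameter X P t].

(** The order at [P] of a function regular at [P]. *)
Definition has_ord (R : realType) (N : nat) (X : set (proj R N))
    (P : proj R N) (f : proj R N -> R[i]) (m : nat) : Prop :=
  exists t u, [/\ local_parameter X P t, regular_at X P u, u P != 0 &
    germ_eq X P f (fun Q => u Q * t Q ^+ m)].

(** The order at [P] of a rational function: [f] need only be meaningful on a
    nonempty open subset of the irreducible curve [X], where it is a quotient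
    [a / b] of functions regular at [P]. *)
Definition has_ratord (R : realType) (N : nat) (X : set (proj R N))
    (P : proj R N) (f : proj R N -> R[i]) (e : int) : Prop :=
  exists (a b : proj R N -> R[i]) (m k : nat),
    [/\ has_ord X P a m, has_ord X P b k, e = m%:Z - k%:Z &
     exists W, [/\ zopen X W, W !=set0 & forall Q, W Q -> a Q = f Q * b Q]].

(** * Genus: the dimension of the space of regular differential forms

    A tangent vector at [P] is a derivation of the local ring at [P] into
    [R[i]]; a differential form assigns to each [P] a function on tangent
    vectors at [P], given locally by [\sum_l a_l dg_l]. *)

Definition tangent (R : realType) (N : nat) (X : set (proj R N))
    (P : proj R N) (D : (proj R N -> R[i]) -> R[i]) : Prop :=
  [/\ forall f g, regular_at X P f -> regular_at X P g -> germ_eq X P f g ->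
        D f = D g,
      forall c f g, regular_at X P f -> regular_at X P g ->
        D (fun Q => c * f Q + g Q) = c * D f + D g &
      forall f g, regular_at X P f -> regular_at X P g ->
        D (fun Q => f Q * g Q) = f P * D g + g P * D f].

Definition regular_form (R : realType) (N : nat) (X : set (proj R N))
    (w : proj R N -> ((proj R N -> R[i]) -> R[i]) -> R[i]) : Prop :=
  forall P, X P -> exists (U : set (proj R N)) (m : nat)
      (a g : 'I_m -> proj R N -> R[i]),
    [/\ zopen X U, U P,
        forall l, regular_on X U (a l) /\ regular_on X U (g l) &
        forall Q D, U Q -> tangent X Q D -> w Q D = \sum_l a l Q * D (g l)].

Definition free_forms (R : realType) (N : nat) (X : set (proj R N)) (m : nat)
    (w : 'I_m -> proj R N -> ((proj R N -> R[i]) -> R[i]) -> R[i]) : Prop :=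
  forall c : 'I_m -> R[i],
    (forall P D, X P -> tangent X P D -> \sum_l c l * w l P D = 0) ->
    forall l, c l = 0.

Definition has_genus (R : realType) (N : nat) (X : set (proj R N)) (g : nat) :
    Prop :=
  (exists w : 'I_g -> _, (forall l, regular_form X (w l)) /\ free_forms X w) /\
  ~ (exists w : 'I_g.+1 -> _,
       (forall l, regular_form X (w l)) /\ free_forms X w).

(** * Hyperelliptic curves *)

(** Locally [f] is given by homogeneous coordinates [w] that are regular
    functions; [w] has no zero since [f Q] is a line. *)
Definition morphism_to_proj (R : realType) (N M : nat) (X : set (proj R N))
    (f : proj R N -> proj R M) : Prop :=
  forall P, X P -> exists (U : set (proj R N))
      (w : proj R N -> 'rV[R[i]]_M.+1),
    [/\ zopen X U, U P, mx_regular_on X U w &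
     forall Q, U Q -> val (f Q) = <[w Q]>%VS].

(** Multiplicity of [f] at [P]: the order at [P] of the pullback of a local
    parameter of P^1 at [f P]. *)
Definition has_mult (R : realType) (N : nat) (X : set (proj R N))
    (f : proj R N -> proj R 1) (P : proj R N) (e : nat) : Prop :=
  exists2 t, local_parameter [set: proj R 1] (f P) t &
    has_ord X P (t \o f) e.

(** Every fibre of [f] has [m] points, counted with multiplicity. *)
Definition morphism_degree (R : realType) (N : nat) (X : set (proj R N))
    (f : proj R N -> proj R 1) (m : nat) : Prop :=
  exists e : proj R N -> nat,
    (forall P, X P -> has_mult X f P (e P)) /\
    forall y : proj R 1,
      finite_set (X `&` f @^-1` [set y]) /\
      (\sum_(P \in X `&` f @^-1` [set y]) (e P)%:Z)%R = m%:Z.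

(** [X] has a degree 2 morphism to P^1.  The usual convention that the genus is
    at least 2 is not part of this definition. *)
Definition hyperelliptic (R : realType) (N : nat) (X : set (proj R N)) : Prop :=
  exists f : proj R N -> proj R 1, morphism_to_proj X f /\ morphism_degree X f 2.

(** * Vector bundles

    A vector bundle of rank [n] is given by an open cover and transition
    matrices; [trans i j] maps coordinates in chart [j] to coordinates in
    chart [i].  Invertibility of [trans i j] follows from the last two
    fields. *)

Record bundle (R : realType) (N : nat) (X : set (proj R N)) (n : nat) := Bundle {
  chart_index : Type;
  chart : chart_index -> set (proj R N);
  trans : chart_index -> chart_index -> proj R N -> 'M[R[i]]_n;
  chart_open : forall i, zopen X (chart i);
  chart_cover : X `<=` [set P | exists i, chart i P];
  trans_regular : forall i j, mx_regular_on X (chart i `&` chart j) (trans i j);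
  trans_id : forall i P, chart i P -> trans i i P = 1%:M;
  trans_cocycle : forall i j k P, chart i P -> chart j P -> chart k P ->
    trans i j P *m trans j k P = trans i k P }.

(** A section over [V], given by its coordinates in all charts. *)
Definition section_on (R : realType) (N : nat) (X : set (proj R N)) (n : nat)
    (E : bundle X n) (V : set (proj R N))
    (s : chart_index E -> proj R N -> 'cV[R[i]]_n) : Prop :=
  (forall i, mx_regular_on X (V `&` chart i) (s i)) /\
  (forall i j P, V P -> chart i P -> chart j P ->
     s i P = trans i j P *m s j P).

Definition free_sections (R : realType) (N : nat) (X : set (proj R N)) (n : nat)
    (E : bundle X n) (m : nat)
    (s : 'I_m -> chart_index E -> proj R N -> 'cV[R[i]]_n) : Prop :=
  forall c : 'I_m -> R[i],
    (forall i P, chart i P -> \sum_l c l *: s l i P = 0) ->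
    forall l, c l = 0.

(** [h^0(E) >= k]; vacuous for [k <= 0]. *)
Definition h0_ge (R : realType) (N : nat) (X : set (proj R N)) (n : nat)
    (E : bundle X n) (k : int) : Prop :=
  exists2 m : nat, k <= m%:Z &
    exists s : 'I_m -> chart_index E -> proj R N -> 'cV[R[i]]_n,
      (forall l, section_on X (s l)) /\ free_sections s.

(** The degree of [E] is the degree of the line bundle [det E], whose
    transition functions are the determinants of those of [E]; it is the degree
    of the divisor [D] of a rational section [s] of [det E]. *)
Definition has_degree (R : realType) (N : nat) (X : set (proj R N)) (n : nat)
    (E : bundle X n) (d : int) : Prop :=
  exists (V : set (proj R N)) (s : chart_index E -> proj R N -> R[i])
      (D : proj R N -> int),
    [/\ zopen X V /\ V !=set0,
        (forall i, regular_on X (V `&` chart i) (s i)) /\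
        (forall i j P, V P -> chart i P -> chart j P ->
           s i P = \det (trans i j P) * s j P),
        forall i P, chart i P -> has_ratord X P (s i) (D P),
        finite_set (X `&` [set P | D P != 0]) &
        (\sum_(P \in X) D P)%R = d].

Definition slope (n : nat) (d : int) : rat := d%:~R / n%:R.

(** [phi i j] is the matrix of the homomorphism from chart [i] of [F] to chart
    [j] of [E]. *)
Definition bundle_hom (R : realType) (N : nat) (X : set (proj R N)) (r n : nat)
    (F : bundle X r) (E : bundle X n)
    (phi : chart_index F -> chart_index E -> proj R N -> 'M[R[i]]_(n, r)) :
    Prop :=
  (forall i j, mx_regular_on X (chart i `&` chart j) (phi i j)) /\
  (forall i i' j j' P, chart i P -> chart i' P -> chart j P -> chart j' P ->
     phi i' j' P = trans j' j P *m phi i j P *m trans i i' P).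

(** Injectivity of the induced homomorphism of sheaves of sections. *)
Definition injective_hom (R : realType) (N : nat) (X : set (proj R N))
    (r n : nat) (F : bundle X r) (E : bundle X n)
    (phi : chart_index F -> chart_index E -> proj R N -> 'M[R[i]]_(n, r)) :
    Prop :=
  forall (V : set (proj R N)) (s : chart_index F -> proj R N -> 'cV[R[i]]_r),
    zopen X V -> section_on V s ->
    (forall i j P, V P -> chart i P -> chart j P -> phi i j P *m s i P = 0) ->
    forall i P, V P -> chart i P -> s i P = 0.

(** Slope stability, tested on the subsheaves [F] of [E] with
    [0 < rk F < rk E]; on a nonsingular curve they are all locally free. *)
Definition stable (R : realType) (N : nat) (X : set (proj R N)) (n : nat)
    (E : bundle X n) : Prop :=
  forall (r : nat) (F : bundle X r)
      (phi : chart_index F -> chart_index E -> proj R N -> 'M[R[i]]_(n, r)),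
    (0 < r < n)%N -> bundle_hom phi -> injective_hom phi ->
    forall dF dE : int, has_degree F dF -> has_degree E dE ->
      slope r dF < slope n dE.

(** * Brill-Noether loci *)

(** [BN_locus X n d k] is the locus W^{k-1}_{n,d}, as a set of bundles (not of
    isomorphism classes). *)
Definition BN_locus (R : realType) (N : nat) (X : set (proj R N)) (n : nat)
    (d k : int) : set (bundle X n) :=
  [set E | [/\ stable E, has_degree E d & h0_ge E k]].

Arguments BN_locus {R N} X n d k.

Definition is_BN (R : realType) (N : nat) (X : set (proj R N)) (n : nat)
    (x : rat * rat) : Prop :=
  exists d k : int,
    [/\ d%:~R = n%:R * x.1, k%:~R = n%:R * x.2 & BN_locus X n d k !=set0].

Definition BGN (g : nat) : set (rat * rat) :=
  [set x | (0 < x.1 <= 1) && (0 < x.2 <= g%:R^-1 * (x.1 + g%:R - 1))]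
  `\` [set (1, 1)].

Definition regionM (g : nat) : set (rat * rat) :=
  [set x | (1 < x.1 < 2) && (0 < x.2 <= g%:R^-1 * (x.1 + g%:R - 1))]
  `|` [set x | (x.1 == 2) && (0 < x.2 < 1)].

Definition affT (d' s : int) (x : rat * rat) : rat * rat :=
  (x.1 + d'%:~R, s%:~R * x.2).

(* Main.v *)
(* Let [f : X -> P^1] be the double cover, with homogeneous coordinates [x], [y],
   let H be the pullback of O(1), of degree 2, and let E be a stable bundle in
   the given Brill-Noether locus.  Its rank is at least 2, since the regions
   contain no integral point.  E(-H) is stable of nonpositive slope, so it has no
   nonzero section.  If [\sum_a x^a y^(s-1-a) w_a = 0] with [w_a] sections of E,
   then [w_(s-1) / y] is a section of E(-H), hence zero; inductively all [w_a]
   vanish.  So [E((s-1)H)], which is stable of degree [d + 2n(s-1)], has at least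
   [s * h^0(E)] independent sections. *)
Require Import Defs.
From HB Require Import structures.
From mathcomp Require Import all_boot all_order all_algebra.
From mathcomp Require Import mpoly complex.
From mathcomp Require Import boolp classical_sets cardinality fsbigop reals.
From mathcomp Require Import zify ring.

Set Implicit Arguments.
Unset Strict Implicit.
Unset Printing Implicit Defensive.

Import Order.TTheory GRing.Theory Num.Theory.

Local Open Scope classical_set_scope.
Local Open Scope ring_scope.

(** * Zariski topology and regular functions *)

(** Degree is a relation here, and stability compares every admissible degree of a subsheaf with
    every admissible degree of the bundle. Stability of E(mH) therefore needs degrees carried along
    the twist in both directions. Each time a rational section of the determinant is multiplied by a
    power of one homogeneous coordinate, whose divisor is a fibre of [f]; this is where the degree 2
    of the cover enters.

    Slope 2 is allowed, so E(-H) may have slope exactly 0. This still excludes sections: a nonzero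
    section makes the trivial line bundle a subsheaf of slope 0, and the stability inequality is
    strict. That subsheaf is tested only if its rank 1 is smaller than the rank of E, hence the need
    to exclude rank one. The line bundle H itself shows the danger: H(-H) is trivial and has a
    section. *)

Section Representatives.
Variables (R : realType) (N : nat).
Implicit Types (P : proj R N) (v : 'rV[R[i]]_N.+1) (p : {mpoly R[i][N.+1]}).

(** Homogeneous conditions need only be tested on one spanning vector. No regularity in [P] is
    claimed for this choice: only expressions of degree zero in its coordinates serve as regular
    functions. *)
Definition rep P : 'rV[R[i]]_N.+1 := vpick (val P).

Lemma rep_mem P : rep P \in val P.
Proof. exact: memv_pick. Qed.

Lemma rep_neq0 P : rep P != 0.
Proof.
by rewrite /rep vpick0; apply/eqP => h; have := valP P; rewrite /= h dimv0.
Qed.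

Lemma val_rep P : val P = <[rep P]>%VS.
Proof.
by apply/eqP; rewrite eq_sym eqEdim -memvE rep_mem dim_vline rep_neq0 (eqP (valP P)).
Qed.

Lemma meval_homogZ p m c v :
  p \is m.-homog -> p.@[(c *: v) 0] = c ^+ m * p.@[v 0].
Proof.
move=> /dhomogP hp; rewrite !mevalE mulr_sumr; apply: eq_big_seq => k /hp <-.
rewrite mulrCA; congr (_ * _).
under eq_bigr do rewrite mxE exprMn.
by rewrite big_split /= prodrXr mdegE.
Qed.

Lemma vanishesP p m P : p \is m.-homog ->
  vanishes p P <-> p.@[rep P 0] = 0.
Proof.
move=> hp; split=> [|h v]; first by apply; exact: rep_mem.
rewrite val_rep => /vlineP[c ->].
by rewrite (meval_homogZ _ _ hp) h mulr0.
Qed.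

End Representatives.

Section ZariskiTopology.
Variables (R : realType) (N : nat).
Implicit Types (X U V : set (proj R N)) (P : proj R N).

Lemma zopen_sub X U : zopen X U -> U `<=` X.
Proof. by case=> Z _ -> P []. Qed.

Lemma zclosed0 : zclosed (set0 : set (proj R N)).
Proof.
exists [set 1]; split=> [p ->|]; first by exists 0%N; exact: dhomog1.
apply/seteqP; split=> // P /(_ _ erefl) /(vanishesP _ (dhomog1 _ _)).
by rewrite meval1 => /eqP; rewrite oner_eq0.
Qed.

Lemma zopenT X : zopen X X.
Proof. by exists set0; [exact: zclosed0 | rewrite setD0]. Qed.

Lemma zclosedU (A B : set (proj R N)) :
  zclosed A -> zclosed B -> zclosed (A `|` B).
Proof.
case=> S [hS ->] [T [hT ->]].
exists [set r | exists p q, [/\ S p, T q & r = p * q]]; split.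
  move=> _ [p [q [/hS[m pm] /hT[k qk] ->]]].
  by exists (m + k)%N; exact: dhomogM.
apply/seteqP; split=> P.
  move=> h _ [p [q [Sp Tq ->]]] v vP; rewrite mevalM.
  by case: h => [/(_ _ Sp _ vP)|/(_ _ Tq _ vP)] ->; rewrite ?mul0r ?mulr0.
move=> h; case: (pselect (forall p, S p -> vanishes p P)); first by left.
move=> /existsNP[p /not_implyP[Sp np]]; right=> q Tq.
have [m pm] := hS _ Sp; have [k qk] := hT _ Tq.
apply/(vanishesP _ qk); have := h _ (ex_intro _ p (ex_intro _ q (And3 Sp Tq erefl))).
move=> /(vanishesP _ (dhomogM pm qk)) /eqP.
by rewrite mevalM mulf_eq0 => /orP[/eqP/(vanishesP _ pm)//|/eqP].
Qed.

Lemma zopenI X U V : zopen X U -> zopen X V -> zopen X (U `&` V).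
Proof.
case=> A cA -> [B cB ->]; exists (A `|` B); first exact: zclosedU.
by rewrite setDUr.
Qed.

Lemma zopen_basic X (p : {mpoly R[i][N.+1]}) m : p \is m.-homog ->
  zopen X (X `&` [set P | p.@[rep P 0] != 0]).
Proof.
move=> hp; exists [set P | forall q, [set p] q -> vanishes q P].
  by exists [set p]; split=> // q ->; exists m.
apply/seteqP; split=> P [XP h]; split=> //.
  by move=> /(_ _ erefl) /(vanishesP _ hp) e; move: h; rewrite /= e eqxx.
by apply/eqP => e; apply: h => q ->; apply/(vanishesP _ hp).
Qed.

(** A closed set is cut out by an arbitrary family of forms, so unions of open sets are open: [S]
    takes every form whose non-vanishing locus in [X] lies in [U]. *)
Lemma zopen_local X U :
  (forall P, U P -> exists V, [/\ zopen X V, V P & V `<=` U]) -> zopen X U.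
Proof.
move=> h; set S := [set p : {mpoly R[i][N.+1]} | (exists m, p \is m.-homog) /\
  forall Q, X Q -> ~ vanishes p Q -> U Q].
exists [set P | forall p, S p -> vanishes p P].
  by exists S; split=> // p [].
apply/seteqP; split=> P.
  move=> UP; have [V [[Z [T [hT ->]] ->] [XP nP] sV]] := h _ UP; split=> // hS.
  move/existsNP: nP => [p /not_implyP[Tp np]]; apply: np; apply: hS.
  split; first exact: hT.
  by move=> Q XQ nQ; apply: sV; split=> // /(_ _ Tp).
by case=> XP /existsNP[p /not_implyP[[_ +] np]]; apply.
Qed.

Lemma zopen_meet X U V : zirreducible X -> zopen X U -> zopen X V ->
  U !=set0 -> V !=set0 -> (U `&` V) !=set0.
Proof.
move=> [_ irr] [A cA ->] [B cB ->] [P [XP nP]] [Q [XQ nQ]].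
apply: contrapT => /nonemptyPn/seteqP[h _].
case: (irr A B cA cB) => [T XT|sub|sub]; [|exact/nP/sub|exact/nQ/sub].
by apply: contrapT => /not_orP[nA nB]; apply: (h T).
Qed.

End ZariskiTopology.

Section RegularFunctions.
Variables (R : realType) (N : nat) (X : set (proj R N)).
Implicit Types (U V : set (proj R N)) (P Q : proj R N) (f g : proj R N -> R[i]).

Lemma regular_atP P f : regular_at X P f <->
  exists U m (p q : {mpoly R[i][N.+1]}),
    [/\ zopen X U, U P, p \is m.-homog, q \is m.-homog &
     forall Q, U Q -> q.@[rep Q 0] != 0 /\ f Q = p.@[rep Q 0] / q.@[rep Q 0]].
Proof.
split=> -[U [m [p [q [oU UP pm qm h]]]]]; exists U, m, p, q; split=> // Q UQ.
  by apply: h => //; [exact: rep_mem | exact: rep_neq0].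
have [q0 ->] := h _ UQ => v; rewrite val_rep => /vlineP[c ->].
rewrite scaler_eq0 negb_or => /andP[c0 _].
rewrite (meval_homogZ _ _ pm) (meval_homogZ _ _ qm).
have cm : c ^+ m != 0 by rewrite expf_neq0.
by split; [rewrite mulf_neq0 | rewrite -mulf_div divff // mul1r].
Qed.

Lemma regular_at_dom P f : regular_at X P f -> X P.
Proof. by case=> U [m [p [q [/zopen_sub + UP _ _ _]]]]; apply. Qed.

Lemma germ_eq_refl P f : X P -> germ_eq X P f f.
Proof. by exists X; split=> //; exact: zopenT. Qed.

Lemma germ_eq_sym P f g : germ_eq X P f g -> germ_eq X P g f.
Proof. by case=> U [oU UP h]; exists U; split=> // Q /h. Qed.

Lemma germ_eq_trans P f g h :
  germ_eq X P f g -> germ_eq X P g h -> germ_eq X P f h.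
Proof.
case=> U [oU UP hU] [V [oV VP hV]]; exists (U `&` V); split=> //.
  exact: zopenI.
by move=> Q [/hU -> /hV].
Qed.

Lemma germ_eqM P f f' g g' : germ_eq X P f f' -> germ_eq X P g g' ->
  germ_eq X P (fun Q => f Q * g Q) (fun Q => f' Q * g' Q).
Proof.
case=> U [oU UP hU] [V [oV VP hV]]; exists (U `&` V); split=> //.
  exact: zopenI.
by move=> Q [/hU -> /hV ->].
Qed.

Lemma germ_eqX P f g m : germ_eq X P f g ->
  germ_eq X P (fun Q => f Q ^+ m) (fun Q => g Q ^+ m).
Proof. by case=> U [oU UP hU]; exists U; split=> // Q /hU ->. Qed.

Lemma regular_at_germ P f g :
  germ_eq X P f g -> regular_at X P f -> regular_at X P g.
Proof.
case=> V [oV VP e] [U [m [p [q [oU UP pm qm h]]]]].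
exists (U `&` V), m, p, q; split=> //; first exact: zopenI.
by move=> Q [/h + /e <-].
Qed.

Lemma regular_at_cst P c : X P -> regular_at X P (fun=> c).
Proof.
move=> XP; apply/regular_atP; exists X, 0%N, (c *: 1), 1.
split; rewrite ?dhomog1 //; [exact: zopenT| exact/dhomogZ/dhomog1 |].
by move=> Q _; rewrite mevalZ meval1 divr1 mulr1 oner_eq0.
Qed.

Lemma regular_atM P f g : regular_at X P f -> regular_at X P g ->
  regular_at X P (fun Q => f Q * g Q).
Proof.
move=> /regular_atP[U [m [p [q [oU UP pm qm h]]]]].
move=> /regular_atP[V [k [r [s [oV VP rk sk h']]]]].
apply/regular_atP; exists (U `&` V), (m + k)%N, (p * r), (q * s).
split=> //; [exact: zopenI | exact: dhomogM | exact: dhomogM |].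
move=> Q [/h[q0 ->] /h'[s0 ->]].
by rewrite !mevalM mulf_neq0 //; split=> //; rewrite mulf_div.
Qed.

Lemma regular_atD P f g : regular_at X P f -> regular_at X P g ->
  regular_at X P (fun Q => f Q + g Q).
Proof.
move=> /regular_atP[U [m [p [q [oU UP pm qm h]]]]].
move=> /regular_atP[V [k [r [s [oV VP rk sk h']]]]].
apply/regular_atP; exists (U `&` V), (m + k)%N, (p * s + r * q), (q * s).
split=> //; [exact: zopenI | | exact: dhomogM |].
  by apply: dhomogD; [|rewrite addnC]; exact: dhomogM.
move=> Q [/h[q0 ->] /h'[s0 ->]].
by rewrite mevalD !mevalM mulf_neq0 //; split=> //; rewrite addf_div.
Qed.

Lemma regular_atV P f : regular_at X P f -> f P != 0 ->
  regular_at X P (fun Q => (f Q)^-1).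
Proof.
move=> /regular_atP[U [m [p [q [oU UP pm qm h]]]]] fP.
have {fP} pP : p.@[rep P 0] != 0.
  by move: fP; have [_ ->] := h _ UP; rewrite mulf_eq0 negb_or => /andP[].
apply/regular_atP; exists (U `&` (X `&` [set Q | p.@[rep Q 0] != 0])), m, q, p.
split=> //; first by apply: zopenI => //; exact: zopen_basic pm.
  by split=> //; split=> //; exact: zopen_sub oU _ UP.
by move=> Q [/h[q0 ->] [_ p0]]; rewrite invf_div.
Qed.

Lemma regular_atX P f m : regular_at X P f ->
  regular_at X P (fun Q => f Q ^+ m).
Proof.
move=> hf; elim: m => [|m IH].
  by under eq_fun do rewrite expr0; exact/regular_at_cst/(regular_at_dom hf).
by under eq_fun do rewrite exprS; exact: regular_atM.
Qed.

Lemma regular_atXz P f (m : int) : regular_at X P f -> f P != 0 ->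
  regular_at X P (fun Q => f Q ^ m).
Proof.
move=> hf f0; case: m => m; first exact: regular_atX.
apply: (regular_atV (f := fun Q => f Q ^+ m.+1)); first exact: regular_atX.
by rewrite expf_neq0.
Qed.

Lemma regular_at_sum P (I : Type) (r : seq I) (A : pred I)
    (F : I -> proj R N -> R[i]) : X P -> (forall i, A i -> regular_at X P (F i)) ->
  regular_at X P (fun Q => \sum_(i <- r | A i) F i Q).
Proof.
move=> XP hF; elim: r => [|i r IH].
  by under eq_fun do rewrite big_nil; exact: regular_at_cst.
under eq_fun do rewrite big_cons.
by case: (A i) (hF i) => // /(_ isT) hi; exact: regular_atD.
Qed.

Lemma regular_at_prod P (I : Type) (r : seq I)
    (F : I -> proj R N -> R[i]) : X P -> (forall i, regular_at X P (F i)) ->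
  regular_at X P (fun Q => \prod_(i <- r) F i Q).
Proof.
move=> XP hF; elim: r => [|i r IH].
  by under eq_fun do rewrite big_nil; exact: regular_at_cst.
under eq_fun do rewrite big_cons.
exact: regular_atM.
Qed.

Lemma regular_at_nearby P f : regular_at X P f ->
  exists U, [/\ zopen X U, U P & regular_on X U f].
Proof.
case=> U [m [p [q [oU UP pm qm h]]]]; exists U; split=> // Q UQ.
by exists U, m, p, q.
Qed.

Lemma zopen_neq0 U f : zopen X U -> regular_on X U f ->
  zopen X (U `&` [set Q | f Q != 0]).
Proof.
move=> oU hf; apply: zopen_local => P [UP fP].
have /regular_atP[V [m [p [q [oV VP pm qm h]]]]] := hf _ UP.
exists (U `&` (V `&` (X `&` [set Q | p.@[rep Q 0] != 0]))); split.
- apply: zopenI => //; apply: zopenI => //; exact: zopen_basic pm.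
- split=> //; split=> //; split; first exact: zopen_sub oU _ UP.
  by move: fP; rewrite /= (h _ VP).2 mulf_eq0 negb_or => /andP[].
- move=> Q [UQ [/h[q0 e] [_ p0]]]; split=> //=.
  by rewrite e mulf_neq0 // invr_eq0.
Qed.

End RegularFunctions.

(** * Orders of regular and rational functions *)

Section Orders.
Variables (R : realType) (N : nat) (X : set (proj R N)).
Implicit Types (U V : set (proj R N)) (P Q : proj R N) (f g : proj R N -> R[i]).

(* If [t' = a t] and [t = b t'] with [a b] vanishing at [P], then [ab = c t] and
   [t (1 - c t) = 0], so the germ of [t] is zero and any unit will do. *)
Lemma local_parameter_unit P t t' :
  local_parameter X P t -> local_parameter X P t' ->
  exists u, [/\ regular_at X P u, u P != 0 & germ_eq X P t' (fun Q => u Q * t Q)].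
Proof.
move=> [rt t0 ht] [rt' t'0 ht']; have XP := regular_at_dom rt.
have [a ra ea] := ht _ rt' t'0; have [b rb eb] := ht' _ rt t0.
have [aP|aP] := eqVneq (a P) 0; last by exists a.
have [c rc ec] := ht _ ra aP.
have rd : regular_at X P (fun Q => 1 + (-1) * (b Q * (c Q * t Q))).
  apply: regular_atD; first exact: regular_at_cst.
  apply: regular_atM; first exact: regular_at_cst.
  by apply: regular_atM => //; exact: regular_atM.
have [V [oV VP rdV]] := regular_at_nearby rd.
have dP : 1 + (-1) * (b P * (c P * t P)) != 0 by rewrite t0 !mulr0 addr0 oner_eq0.
have [A [oA AP hA]] := ea; have [B [oB BP hB]] := eb; have [C [oC CP hC]] := ec.
exists (fun=> 1); split; [exact: regular_at_cst | by rewrite oner_eq0 |].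
exists (((A `&` B) `&` C) `&` (V `&` [set Q | 1 + (-1) * (b Q * (c Q * t Q)) != 0])).
split=> //.
  by apply: zopenI; [apply: zopenI => //; exact: zopenI | exact: zopen_neq0].
move=> Q [[[/hA eA /hB eB] /hC eC] [_ /= d0]].
have tQ : t Q = 0.
  apply/eqP; move: (mulf_eq0 (t Q) (1 + (-1) * (b Q * (c Q * t Q)))).
  rewrite (negPf d0) orbF => <-; apply/eqP.
  rewrite mulrDr mulr1 {1}eB eA eC mulN1r.
  rewrite mulrN; apply/eqP; rewrite subr_eq0; apply/eqP.
  by rewrite [RHS]mulrC -!mulrA.
by rewrite mul1r eA tQ mulr0.
Qed.

(** [has_ord] names some parameter; any other differs from it by a unit [w], which only changes the
    unit factor by [w ^+ m]. Orders of two functions can thus be read off with a common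
    parameter. *)
Lemma has_ordE P f m t : local_parameter X P t -> has_ord X P f m ->
  exists u, [/\ regular_at X P u, u P != 0 &
    germ_eq X P f (fun Q => u Q * t Q ^+ m)].
Proof.
move=> lt [t' [u [lt' ru u0 e]]].
have [w [rw w0 ew]] := local_parameter_unit lt lt'.
exists (fun Q => u Q * w Q ^+ m); split.
- by apply: regular_atM => //; exact: regular_atX.
- by rewrite mulf_neq0 // expf_neq0.
- apply: germ_eq_trans e _.
  have := germ_eqM (germ_eq_refl u (regular_at_dom ru)) (germ_eqX m ew).
  by under [X in germ_eq _ _ _ X -> _]eq_fun do rewrite exprMn mulrA.
Qed.

Lemma has_ord_param P f m : has_ord X P f m -> exists t, local_parameter X P t.
Proof. by case=> t [u [lt _ _ _]]; exists t. Qed.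

Lemma has_ordM P f g m k : has_ord X P f m -> has_ord X P g k ->
  has_ord X P (fun Q => f Q * g Q) (m + k).
Proof.
move=> [t [u [lt ru u0 e]]] /(has_ordE lt)[w [rw w0 e']].
exists t, (fun Q => u Q * w Q); split=> //; first exact: regular_atM.
  exact: mulf_neq0.
apply: germ_eq_trans (germ_eqM e e') _.
by under eq_fun do rewrite mulrACA -exprD;
  exact/germ_eq_refl/(regular_at_dom ru).
Qed.

Lemma has_ord_unit P f t : local_parameter X P t -> regular_at X P f -> f P != 0 ->
  has_ord X P f 0.
Proof.
move=> lt rf f0; exists t, f; split=> //.
by under eq_fun do rewrite expr0 mulr1; exact/germ_eq_refl/(regular_at_dom rf).
Qed.

Lemma has_ordX P f m k : has_ord X P f m -> has_ord X P (fun Q => f Q ^+ k) (k * m).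
Proof.
move=> hf; have [t lt] := has_ord_param hf.
have XP : X P by case: lt => /regular_at_dom.
elim: k => [|k IH].
  by apply: has_ord_unit lt _ _; rewrite ?oner_eq0 //; exact: regular_at_cst.
by rewrite mulSn; under eq_fun do rewrite exprS; exact: has_ordM.
Qed.

Lemma has_ratord_ext P f g e W : zirreducible X -> zopen X W -> W !=set0 ->
  (forall Q, W Q -> f Q = g Q) -> has_ratord X P f e -> has_ratord X P g e.
Proof.
move=> irr oW nW fg [a [b [m [k [ha hb -> [V [oV nV hV]]]]]]].
exists a, b, m, k; split=> //; exists (V `&` W); split.
- exact: zopenI.
- exact: (zopen_meet irr).
- by move=> Q [/hV -> /fg ->].
Qed.

(** A negative power of [h] goes into the denominator of the fraction; cancelling it there is why
    [h] has to be nonzero on a nonempty open set. *)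
Lemma has_ratordMz P f e h (m : nat) W (k : int) : zirreducible X ->
  zopen X W -> W !=set0 -> (forall Q, W Q -> h Q != 0) ->
  has_ratord X P f e -> has_ord X P h m ->
  has_ratord X P (fun Q => f Q * h Q ^ k) (e + k * m%:Z).
Proof.
move=> irr oW nW h0 [a [b [i [j [ha hb -> [V [oV nV hV]]]]]]] hh.
case: k => k.
  exists (fun Q => a Q * h Q ^+ k), b, (i + k * m)%N, j; split=> //.
  - by apply: has_ordM => //; exact: has_ordX.
  - by rewrite PoszD PoszM addrAC.
  - by exists V; split=> // Q /hV ->; rewrite mulrAC.
exists a, (fun Q => b Q * h Q ^+ k.+1), i, (j + k.+1 * m)%N; split=> //.
- by apply: has_ordM => //; exact: has_ordX.
- by rewrite PoszD PoszM NegzE mulNr opprD addrA.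
- exists (V `&` W); split; [exact: zopenI | exact: (zopen_meet irr) |].
  move=> Q [/hV -> /h0 hQ]; rewrite NegzE -exprnN.
  by rewrite mulrACA mulVf ?mulr1 // expf_neq0.
Qed.

End Orders.

(** * Pullback along a morphism to projective space *)

Lemma dhomog_mpolyXU (R : realType) N (i : 'I_N.+1) :
  ('X_i : {mpoly R[i][N.+1]}) \is 1.-homog.
Proof. by rewrite dhomogX /= mdeg1. Qed.

Section Pullback.
Variables (R : realType) (N M : nat) (X : set (proj R N)).
Variable f : proj R N -> proj R M.
Hypothesis mor_f : morphism_to_proj X f.

Lemma regular_at_meval P (p : {mpoly R[i][M.+1]}) (w : proj R N -> 'rV[R[i]]_M.+1) :
  X P -> (forall i j, regular_at X P (fun Q => w Q i j)) ->
  regular_at X P (fun Q => p.@[w Q 0]).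
Proof.
move=> XP hw; under eq_fun do rewrite mevalE.
apply: regular_at_sum => // k _; apply: regular_atM; first exact: regular_at_cst.
by apply: regular_at_prod => // i; exact: regular_atX.
Qed.

(** Substituting the local coordinates [w] into a form gives a regular function on [U], whose
    non-vanishing locus is open; homogeneity makes the condition depend on the line [f Q] only. *)
Lemma zopen_preimage V : zopen [set: proj R M] V -> zopen X (X `&` f @^-1` V).
Proof.
case=> Z [S [hS ->]] ->; apply: zopen_local => P [XP [_ nP]].
move/existsNP: nP => [p /not_implyP[Sp np]]; have [m pm] := hS _ Sp.
have [U [w [oU UP rw hw]]] := mor_f XP.
have pw Q : U Q -> vanishes p (f Q) <-> p.@[w Q 0] = 0.
  move=> UQ; split=> [|e v]; first by apply; rewrite hw // memv_line.
  by rewrite hw // => /vlineP[c ->]; rewrite (meval_homogZ _ _ pm) e mulr0.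
exists (U `&` [set Q | p.@[w Q 0] != 0]); split.
- apply: zopen_neq0 => // Q UQ; apply: regular_at_meval.
    exact: zopen_sub oU _ UQ.
  by move=> i j; exact: rw.
- by split=> //; apply/eqP => /(pw _ UP).
- move=> Q [UQ /= p0]; split; first exact: zopen_sub oU _ UQ.
  by split=> // /(_ _ Sp)/(pw _ UQ)/eqP; exact/negP.
Qed.

Lemma regular_at_comp P a : X P -> regular_at [set: proj R M] (f P) a ->
  regular_at X P (a \o f).
Proof.
move=> XP [V [m [p [q [oV VP pm qm h]]]]].
have [U [w [oU UP rw hw]]] := mor_f XP.
have w0 Q : U Q -> w Q != 0.
  move=> UQ; apply/eqP => wQ; have := rep_mem (f Q).
  by rewrite hw // wQ => /vlineP[c]; rewrite scaler0; apply/eqP/rep_neq0.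
have hq Q : (U `&` (X `&` f @^-1` V)) Q ->
    q.@[w Q 0] != 0 /\ a (f Q) = p.@[w Q 0] / q.@[w Q 0].
  by move=> [UQ [XQ VQ]]; apply: h VQ _ _ (w0 _ UQ); rewrite hw // memv_line.
have nP : (U `&` (X `&` f @^-1` V)) P by [].
apply: (regular_at_germ (f := fun Q => p.@[w Q 0] / q.@[w Q 0])).
  exists (U `&` (X `&` f @^-1` V)); split=> //.
    by apply: zopenI => //; exact: zopen_preimage.
  by move=> Q /hq[].
apply: regular_atM; first by apply: regular_at_meval => // i j; exact: rw.
apply: regular_atV; last by have [] := hq _ nP.
by apply: regular_at_meval => // i j; exact: rw.
Qed.

Lemma germ_eq_comp P a b : X P -> germ_eq [set: proj R M] (f P) a b ->
  germ_eq X P (a \o f) (b \o f).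
Proof.
move=> XP [V [oV VP e]]; exists (X `&` f @^-1` V); split=> //.
  exact: zopen_preimage.
by move=> Q [_ /e].
Qed.

Lemma regular_at_coord_ratio (Q : proj R M) (b c : 'I_M.+1) : rep Q 0 b != 0 ->
  regular_at [set: proj R M] Q (fun Q' => rep Q' 0 c / rep Q' 0 b).
Proof.
move=> Q0; apply/regular_atP.
exists ([set: proj R M] `&`
  [set Q | ('X_b : {mpoly R[i][M.+1]}).@[rep Q 0] != 0]), 1%N, 'X_c, 'X_b.
split; rewrite ?dhomog_mpolyXU //=; first exact/zopen_basic/dhomog_mpolyXU.
  by split=> //=; rewrite mevalXU.
by move=> Q' [_ /=]; rewrite !mevalXU.
Qed.

Definition coord_open (b : 'I_M.+1) : set (proj R N) :=
  X `&` [set Q | rep (f Q) 0 b != 0].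

Lemma zopen_coord b : zopen X (coord_open b).
Proof.
have := zopen_preimage (zopen_basic [set: proj R M] (dhomog_mpolyXU R b)).
congr (zopen X _); apply/seteqP; split=> Q /=.
  by move=> [XQ [_ /=]]; rewrite mevalXU.
by move=> [XQ h]; split=> //; split=> //=; rewrite mevalXU.
Qed.

Lemma coord_open_cover P : X P -> exists b, coord_open b P.
Proof.
move=> XP; apply: contrapT => /forallNP h; have /eqP := rep_neq0 (f P); apply.
apply/rowP => b; rewrite mxE; apply/eqP/negPn/negP => nb.
by apply: (h b).
Qed.

(** The section x_c of H in the trivialization by x_b; it is also the transition function of H
    between the trivializations by x_c and x_b. *)
Definition coord_ratio (b c : 'I_M.+1) (Q : proj R N) : R[i] :=
  rep (f Q) 0 c / rep (f Q) 0 b.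

Lemma coord_ratio_regular b c : regular_on X (coord_open b) (coord_ratio b c).
Proof.
move=> P [XP Pb].
apply: (regular_at_comp (a := fun Q => rep Q 0 c / rep Q 0 b)) => //.
exact: regular_at_coord_ratio.
Qed.

Lemma coord_ratio_neq0 b c P : coord_open b P -> coord_open c P ->
  coord_ratio b c P != 0.
Proof. by move=> [_ /= h] [_ /= h']; rewrite mulf_neq0 // invr_eq0. Qed.

End Pullback.

Lemma ord2_neq0 (i : 'I_2) : i != 0 -> i = 1.
Proof. by case: i => -[|[|//]] hi // _; exact: val_inj. Qed.

(** * A local parameter on the projective line *)

Section ProjectiveLine.
Variable R : realType.

Lemma rep_coord0_neq0 (y : proj R 1) : rep y 0 1 = 0 -> rep y 0 0 != 0.
Proof.
move=> y1; apply: contraNneq (rep_neq0 y) => y0; apply/eqP/rowP => b.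
by rewrite mxE; have [->//|/ord2_neq0->] := eqVneq b 0.
Qed.

Lemma proj_coord_point N (i : 'I_N.+1) :
  exists y : proj R N, val y = <[(delta_mx 0 i : 'rV[R[i]]_N.+1)%R]>%VS.
Proof.
have d : \dim <[(delta_mx 0 i : 'rV[R[i]]_N.+1)%R]>%VS == 1%N.
  rewrite dim_vline eqb1; apply/eqP => /rowP/(_ i)/eqP.
  by rewrite !mxE !eqxx oner_eq0.
by exists (exist (fun L : {vspace 'rV[R[i]]_N.+1} => is_true (\dim L == 1%N)) _ d).
Qed.

(** A form of degree m vanishing at (1 : 0) has no monomial X_0^m, hence is divisible by X_1;
    multiplying the quotient by X_0 restores the degree. *)
Lemma local_parameter_coord_ratio (y : proj R 1) : rep y 0 1 = 0 ->
  local_parameter [set: proj R 1] y (fun Q => rep Q 0 1 / rep Q 0 0).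
Proof.
move=> y1; have y0 := rep_coord0_neq0 y1.
split; [exact: regular_at_coord_ratio | by rewrite y1 mul0r |].
move=> f /regular_atP[U [m [p [q [oU Uy pm qm h]]]]] fy.
have py : p.@[rep y 0] = 0.
  by apply/eqP; have [q0 e] := h _ Uy; move/eqP: fy;
     rewrite e mulf_eq0 invr_eq0 (negPf q0) orbF.
have hk k : k \in msupp p -> (0 < k 1%R)%N.
  move=> kp; rewrite lt0n; apply/negP => /eqP k1.
  have mk : mdeg k = m by exact: (dhomogP _ _ _ pm).
  have := py; rewrite mevalE (bigD1_seq k) ?msupp_uniq //= [X in _ + X]big1_seq.
    rewrite addr0; apply/eqP; rewrite mulf_eq0 mcoeff_eq0 kp orFb.
    apply/prodf_neq0 => i _; have [->|i0] := eqVneq i 0; first by rewrite expf_neq0.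
    by rewrite (ord2_neq0 i0) k1 oner_eq0.
  move=> l /andP[lk lp]; apply/eqP; rewrite mulf_eq0.
  apply/orP; right; apply/prodf_eq0; exists 1 => //; rewrite y1 expr0n.
  case: (eqVneq (l 1) 0%N) => [l1|//].
  (* Two monomials of degree m without X_1 are both X_0^m. *)
  case/eqP: lk; apply/mnmP => i.
  have : mdeg l = m by exact: (dhomogP _ _ _ pm).
  rewrite -mk !mdegE !big_ord_recl !big_ord0 !addn0.
  have -> : lift ord0 ord0 = 1 :> 'I_2 by exact: val_inj.
  rewrite l1 k1 !addn0 => e.
  by have [->//|/ord2_neq0->] := eqVneq i 0; rewrite k1 l1.
have hs k : k \in msupp p -> (k - U_(1) + U_(1))%MM = k.
  move=> /hk k1; apply: submK; apply/mnm_lepP => i; rewrite mnm1E.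
  by case: eqP => // <-.
(* [p' = p * X_0 / X_1] *)
pose p' : {mpoly R[i][2]} := \sum_(k <- msupp p) p@_k *: 'X_[(U_(0%R) + (k - U_(1)))%MM].
have p'm : p' \is m.-homog.
  rewrite /p' big_seq; apply: rpred_sum => k kp; apply: dhomogZ; rewrite dhomogX /=.
  by rewrite -(dhomogP _ _ _ pm k kp) -{2}(hs _ kp) /= !mdegD !mdeg1 addnC.
have p'E v : p'.@[v] * v 1 = v 0 * p.@[v].
  have e : p' * 'X_1 = 'X_0 * p.
    rewrite [in RHS](mpolyE p) mulr_sumr mulr_suml big_seq [RHS]big_seq.
    apply: eq_bigr => k kp; rewrite -scalerAl -scalerAr -!mpolyXD.
    by rewrite -addmA hs.
  by have := congr1 (meval v) e; rewrite !mevalM !mevalXU.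
exists (fun Q => p'.@[rep Q 0] / q.@[rep Q 0]).
  by apply/regular_atP; exists U, m, p', q; split=> // Q /h[].
exists (U `&` ([set: proj R 1] `&` [set Q | ('X_0 : {mpoly R[i][2]}).@[rep Q 0] != 0])).
split.
- by apply: zopenI => //; exact/zopen_basic/dhomog_mpolyXU.
- by split=> //; split=> //=; rewrite mevalXU.
- move=> Q [/h[q0 ->] [_ /=]]; rewrite mevalXU => Q0.
  by rewrite mulf_div p'E (mulrC q.@[_] _) -mulf_div divff // mul1r.
Qed.

End ProjectiveLine.

(** * Twisting by powers of the hyperelliptic line bundle *)

Lemma has_ord_germ (R : realType) (N : nat) (X : set (proj R N)) P
    (f g : proj R N -> R[i]) m :
  germ_eq X P f g -> has_ord X P f m -> has_ord X P g m.
Proof.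
move=> fg [t [u [lt ru u0 e]]]; exists t, u; split=> //.
exact: germ_eq_trans (germ_eq_sym fg) e.
Qed.

(** A sum over an infinite support defaults to zero, so supports have to be kept finite along with
    the sums. All three sums are restricted to the union [B] of both supports. *)
Lemma fsumrD_supp (T : choiceType) (A : set T) (F G : T -> int) :
  finite_set (A `&` [set x | F x != 0]) -> finite_set (A `&` [set x | G x != 0]) ->
  finite_set (A `&` [set x | F x + G x != 0]) /\
  \sum_(x \in A) (F x + G x) = \sum_(x \in A) F x + \sum_(x \in A) G x.
Proof.
move=> fF fG.
pose B := A `&` [set x | F x != 0] `|` A `&` [set x | G x != 0].
have fB : finite_set B by rewrite finite_setU.
have BA : B `<=` A by move=> x [[]|[]].
have B0 x : (A `\` B) x -> F x = 0 /\ G x = 0.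
  move=> [Ax nB]; split; apply/eqP/negPn/negP => h; apply: nB; [left|right]; by [].
split.
  apply: sub_finite_set fB => x [Ax /= h]; apply: contrapT => nB.
  by have [Fx Gx] := B0 x (conj Ax nB); move: h; rewrite Fx Gx addr0 eqxx.
rewrite -(fsbig_widen B A _ BA) //; last first.
  by move=> x /B0[/= -> ->]; rewrite addr0.
rewrite -(fsbig_widen B A F BA); last by move=> x /B0[].
rewrite -(fsbig_widen B A G BA); last by move=> x /B0[].
exact: fsbig_split.
Qed.

(** * The divisor of a homogeneous coordinate on the double cover *)

Section ZeroDivisor.
Variables (R : realType) (N : nat) (X : set (proj R N)).
Variable f : proj R N -> proj R 1.
Hypothesis mor_f : morphism_to_proj X f.
Hypothesis deg_f : morphism_degree X f 2.

(** The fibre over (0 : 1) has degree 2, while the degree of an empty fibre would be an empty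
    sum. *)
Lemma coord_open1_nonempty : coord_open X f 1 !=set0.
Proof.
have [y hy] := proj_coord_point R (1 : 'I_2).
have [e [_ /(_ y) [_ se]]] := deg_f.
have [[P [XP fP]]|] := pselect ((X `&` f @^-1` [set y]) !=set0).
  exists P; split=> //=; have := rep_neq0 (f P); have := rep_mem (f P).
  rewrite fP hy => /vlineP[c ->]; rewrite !mxE !eqxx mulr1.
  by apply: contraNneq => ->; rewrite scale0r.
by move=> /nonemptyPn X0; move: se; rewrite X0 fsbig_set0.
Qed.

(** [delta] is the divisor of the section x_1 of H, that is, the fibre over (1 : 0) with the
    multiplicities of [f]. *)
Lemma zero_divisor_coord : exists delta : proj R N -> nat,
  [/\ forall P b, coord_open X f b P -> has_ord X P (coord_ratio f b 1) (delta P),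
      finite_set (X `&` [set P | (delta P)%:Z != 0]) &
      \sum_(P \in X) (delta P)%:Z = 2].
Proof.
have [y hy] := proj_coord_point R (0 : 'I_2).
have [e [he /(_ y) [fine sume]]] := deg_f.
have y1 : rep y 0 1 = 0.
  by have := rep_mem y; rewrite hy => /vlineP[c ->]; rewrite !mxE mulr0.
exists (fun P => if P \in f @^-1` [set y] then e P else 0%N); split.
- move=> P b Pb; have XP : X P by case: Pb.
  have [t ht [t' [u [lt' _ _ _]]]] := he _ XP.
  case: ifPn => [|/negP]; rewrite inE => fP.
    have b0 : b = 0.
      have [//|/ord2_neq0 b1] := eqVneq b 0.
      by move: Pb => [_ /=]; rewrite b1 fP y1 eqxx.
    have {lt' t' u} [s hs os] := he _ XP.
    rewrite fP in hs.
    (* The multiplicity is measured with some parameter [s] at the image point; x_1 / x_0 differs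
       from [s] by a unit, whose pullback is again a unit. *)
    have [u [ru u0 eu]] := local_parameter_unit hs (local_parameter_coord_ratio y1).
    rewrite -fP in ru u0 eu.
    have := germ_eq_comp mor_f XP eu; rewrite b0 => /germ_eq_sym/has_ord_germ; apply.
    rewrite -[e P]add0n; apply: (has_ordM _ os).
    by have [p lp] := has_ord_param os; apply: has_ord_unit lp _ u0;
       exact: regular_at_comp.
  (* Off this fibre x_1 is nonzero, since x_1 = 0 would force [f P] to be (1 : 0). *)
  apply: (has_ord_unit lt'); first exact: coord_ratio_regular.
  apply: coord_ratio_neq0 Pb _; split=> //=; apply/eqP => f1; apply: fP.
  have r0 : rep (f P) = rep (f P) 0 0 *: delta_mx 0 0.
    apply/rowP => c; rewrite !mxE eqxx.
    by have [->|/ord2_neq0->] := eqVneq c 0; rewrite ?mulr1 ?mulr0.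
  apply: val_inj; apply/eqP; rewrite hy eqEdim dim_vline (eqP (valP (f P))).
  by rewrite val_rep -memvE r0 memvZ ?memv_line //= leq_b1.
- by apply: sub_finite_set fine => P [XP /=]; case: ifPn => //; rewrite inE.
- rewrite -[RHS]sume fsbig_mkcondr; apply: eq_fsbigr => P _.
  by case: ifP.
Qed.

End ZeroDivisor.

(* The charts of [twist] below cannot be indexed by ['I_2]: its universe is too
   large to be a [chart_index]. *)
Definition coord_index (b : bool) : 'I_2 := if b then 1 else 0.

Section Twist.
Variables (R : realType) (N : nat) (X : set (proj R N)).
Variable f : proj R N -> proj R 1.
Hypothesis mor_f : morphism_to_proj X f.
Implicit Types (b c : 'I_2) (m : int).

Lemma coord_ratioM b c d P : coord_open X f c P ->
  coord_ratio f b c P * coord_ratio f c d P = coord_ratio f b d P.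
Proof. by move=> [_ /= c0]; rewrite /coord_ratio mulrC mulrA divfK. Qed.

Lemma coord_index_cover P : X P -> exists b : bool, coord_open X f (coord_index b) P.
Proof.
move=> /(coord_open_cover f)[b bP]; exists (b != 0).
rewrite (_ : coord_index _ = b) // /coord_index.
by have [->//|/ord2_neq0->] := eqVneq b 0.
Qed.

Lemma coord_ratio_id b P : coord_open X f b P -> coord_ratio f b b P = 1.
Proof. by move=> [_ /= b0]; rewrite /coord_ratio divff. Qed.

Variables (n : nat) (E : bundle X n).

Definition twist_chart (ib : chart_index E * bool) : set (proj R N) :=
  chart ib.1 `&` coord_open X f (coord_index ib.2).

Definition twist_trans m (ib jc : chart_index E * bool) (P : proj R N) : 'M[R[i]]_n :=
  coord_ratio f (coord_index ib.2) (coord_index jc.2) P ^ m *: trans ib.1 jc.1 P.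

Lemma twist_chart_open ib : zopen X (twist_chart ib).
Proof. by apply: zopenI; [exact: chart_open | exact: zopen_coord]. Qed.

Lemma twist_chart_cover : X `<=` [set P | exists ib, twist_chart ib P].
Proof.
move=> P XP; have [i iP] := chart_cover E XP.
by have [b bP] := coord_index_cover XP; exists (i, b).
Qed.

Lemma twist_trans_regular m ib jc :
  mx_regular_on X (twist_chart ib `&` twist_chart jc) (twist_trans m ib jc).
Proof.
move=> k l P [[iP bP] [jP cP]]; under eq_fun do rewrite mxE.
apply: regular_atM; last exact: trans_regular.
by apply: regular_atXz; [exact: coord_ratio_regular | exact: coord_ratio_neq0 bP cP].
Qed.

Lemma twist_trans_id m ib P : twist_chart ib P -> twist_trans m ib ib P = 1%:M.
Proof.
move=> [iP bP]; rewrite /twist_trans trans_id //.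
by rewrite (coord_ratio_id bP) exp1rz scale1r.
Qed.

Lemma twist_trans_cocycle m ib jc kd P :
  twist_chart ib P -> twist_chart jc P -> twist_chart kd P ->
  twist_trans m ib jc P *m twist_trans m jc kd P = twist_trans m ib kd P.
Proof.
move=> [iP bP] [jP cP] [kP dP].
rewrite /twist_trans -scalemxAl -scalemxAr scalerA trans_cocycle //.
by rewrite -expfzMl (coord_ratioM _ _ cP).
Qed.

(* [E] tensored with the [m]-th power of the pullback of O(1) by [f]. *)
Definition twist m : bundle X n :=
  Bundle twist_chart_open twist_chart_cover (@twist_trans_regular m)
    (@twist_trans_id m) (@twist_trans_cocycle m).

End Twist.

(** * Degrees of the twists *)

Section TwistDegree.
Variables (R : realType) (N : nat) (X : set (proj R N)).
Variable f : proj R N -> proj R 1.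
Hypothesis mor_f : morphism_to_proj X f.
Hypothesis deg_f : morphism_degree X f 2.
Hypothesis irr_X : zirreducible X.
Variables (n : nat) (E : bundle X n) (m : int).

Lemma detZz (a : R[i]) (A : 'M[R[i]]_n) : \det (a ^ m *: A) = a ^ (m * n%:Z) * \det A.
Proof. by rewrite detZ -exprz_exp. Qed.

Lemma degree_add_multiple (k : int) (D : proj R N -> int) (delta : proj R N -> nat) :
  finite_set (X `&` [set P | D P != 0]) ->
  finite_set (X `&` [set P | (delta P)%:Z != 0]) ->
  \sum_(P \in X) (delta P)%:Z = 2 ->
  finite_set (X `&` [set P | D P + k * (delta P)%:Z != 0]) /\
  \sum_(P \in X) (D P + k * (delta P)%:Z) = \sum_(P \in X) D P + 2 * k.
Proof.
move=> fD fd sd.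
have fk : finite_set (X `&` [set P | k * (delta P)%:Z != 0]).
  by apply: sub_finite_set fd => P [XP /= h]; split=> //=;
     apply: contraNneq h => ->; rewrite mulr0.
have [? ->] := fsumrD_supp fD fk; split=> //.
by rewrite -mulr_fsumr sd mulrC.
Qed.

(** The determinant of E(mH) is that of E twisted by (mn)H, so x_1^(mn) times a rational section of
    det E is a rational section of it. *)
Lemma has_degree_twist d :
  has_degree E d -> has_degree (twist mor_f E m) (d + 2 * (m * n%:Z)).
Proof.
move=> [V [s [D [[oV nV] [rs ts] hD fD <-]]]].
have [delta [hd fd sd]] := zero_divisor_coord mor_f deg_f.
have [f' s'] := degree_add_multiple (m * n%:Z) fD fd sd.
have o1 := zopen_coord mor_f 1.
have n1 := coord_open1_nonempty deg_f.
(* For negative m the power of x_1 is regular only where x_1 is nonzero. *)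
exists (V `&` coord_open X f 1).
exists (fun ib Q => s ib.1 Q * coord_ratio f (coord_index ib.2) 1 Q ^ (m * n%:Z)).
exists (fun P => D P + (m * n%:Z) * (delta P)%:Z); split=> //.
- by split; [exact: zopenI | exact: (zopen_meet irr_X)].
- split=> [[i b] P [[VP P1] [iP bP]]|[i b] [j c] P [VP P1] [iP bP] [jP cP]] /=.
    apply: regular_atM; first exact: rs.
    apply: regular_atXz; first exact: coord_ratio_regular.
    exact: coord_ratio_neq0 bP P1.
  rewrite /twist_trans detZz (ts _ _ _ VP iP jP) /=.
  rewrite -(coord_ratioM (coord_index b) 1 cP) expfzMl.
  by rewrite mulrACA (mulrC (\det _)).
- move=> [i b] P [iP bP] /=.
  apply: (has_ratordMz (W := coord_open X f (coord_index b) `&` coord_open X f 1)) => //.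
  + by apply: zopenI => //; exact: zopen_coord.
  + by apply: (zopen_meet irr_X) => //; [exact: zopen_coord | exists P].
  + by move=> Q [bQ Q1]; exact: coord_ratio_neq0 bQ Q1.
  + exact: hD.
  + exact: hd.
Qed.

Lemma has_degree_untwist d :
  has_degree (twist mor_f E m) d -> has_degree E (d - 2 * (m * n%:Z)).
Proof.
move=> [V [s [D [[oV nV] [rs ts] hD fD <-]]]].
have [delta [hd fd sd]] := zero_divisor_coord mor_f deg_f.
have [f' s'] := degree_add_multiple (- (m * n%:Z)) fD fd sd.
have o1 := zopen_coord mor_f 1.
have n1 := coord_open1_nonempty deg_f.
(* In the trivialization by x_1, a coordinate of [s] is [s] divided by x_1^(mn), hence a coordinate
   of a rational section of det E. *)
exists (V `&` coord_open X f 1), (fun i => s (i, true)).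
exists (fun P => D P + - (m * n%:Z) * (delta P)%:Z); split=> //.
- by split; [exact: zopenI | exact: (zopen_meet irr_X)].
- split=> [i P [[VP P1] iP]|i j P [VP P1] iP jP]; first exact: rs.
  rewrite (ts (i, true) (j, true) P) //= /twist_trans /= (coord_ratio_id P1).
  by rewrite exp1rz scale1r.
- move=> i P iP; have XP := zopen_sub (chart_open i) iP.
  (* The chart [i] may contain zeros of x_1, so the order at [P] is taken in a chart where x_b is
     nonzero at [P] and corrected by (x_1 / x_b)^(-mn). *)
  have [b bP] := coord_index_cover f XP.
  have ob : zopen X (coord_open X f (coord_index b)) by exact: zopen_coord.
  apply: (has_ratord_ext
    (f := fun Q => s (i, b) Q * coord_ratio f (coord_index b) 1 Q ^ (- (m * n%:Z)))
    (W := (V `&` coord_open X f 1) `&` (chart i `&` coord_open X f (coord_index b)))) => //.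
  + by apply: zopenI; apply: zopenI => //; exact: chart_open.
  + apply: (zopen_meet irr_X); [exact: zopenI | | exact: (zopen_meet irr_X) | by exists P].
    by apply: zopenI => //; exact: chart_open.
  + move=> Q [[VQ Q1] [iQ bQ]]; rewrite (ts (i, b) (i, true) Q) //= /twist_trans /=.
    rewrite detZz trans_id // det1 mulr1 mulrAC -expfzDr ?subrr ?mul1r //.
    exact: coord_ratio_neq0 bQ Q1.
  + apply: (has_ratordMz (W := coord_open X f (coord_index b) `&` coord_open X f 1)) => //.
    * exact: zopenI.
    * by apply: (zopen_meet irr_X) => //; exists P.
    * by move=> Q [bQ Q1]; exact: coord_ratio_neq0 bQ Q1.
    * exact: (hD (i, b)).
    * exact: hd.
- by rewrite s' mulrN.
Qed.

End TwistDegree.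

(** * Stability of the twists *)

Section TwistStable.
Variables (R : realType) (N : nat) (X : set (proj R N)).
Variable f : proj R N -> proj R 1.
Hypothesis mor_f : morphism_to_proj X f.
Hypothesis deg_f : morphism_degree X f 2.
Hypothesis irr_X : zirreducible X.

Lemma slopeD n (d k : int) : (0 < n)%N ->
  slope n (d + k * n%:Z) = slope n d + k%:~R.
Proof.
move=> n0; rewrite /slope rmorphD rmorphM /= mulrDl -pmulrn mulfK //.
by rewrite pnatr_eq0 -lt0n.
Qed.

(** A subsheaf F of E(mH) becomes the subsheaf F(-mH) of E, and both slopes drop by 2m. *)
Lemma twist_stable n (E : bundle X n) m : stable E -> stable (twist mor_f E m).
Proof.
move=> stE r F phi /andP[r0 rn] [rphi cphi] iphi dF dE hF hE.
have n0 : (0 < n)%N := ltn_trans r0 rn.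
(* With the same x_b trivializing H on both sides, twisting a homomorphism leaves its matrix
   unchanged. *)
pose psi (ib : chart_index (twist mor_f F (- m))) (j : chart_index E) :=
  phi ib.1 (j, ib.2).
have hpsi : bundle_hom psi.
  split=> [[i b] j k l P [[iP bP] jP]|[i b] [i' b'] j j' P [iP bP] [i'P b'P] jP j'P] /=.
    by apply: rphi; split.
  rewrite /psi (cphi i i' (j, b) (j', b') P) //= /twist_trans /=.
  rewrite -!scalemxAl -!scalemxAr /=; congr (_ *: _).
  rewrite -exprz_inv /coord_ratio invf_div //.
have ipsi : injective_hom psi.
  move=> V t oV [rt ct] t0 [i b] P VP [iP bP].
  (* Where x_b is nonzero, its trivialization turns a section of F(-mH) into a section of F, to
     which injectivity of [phi] applies. *)
  pose t' (i' : chart_index F) := t (i', b).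
  have oVb : zopen X (V `&` coord_open X f (coord_index b)).
    by apply: zopenI => //; exact: zopen_coord.
  apply: (iphi _ t' oVb) => //.
    split=> [k l c Q [[VQ bQ] kQ]|k l Q [VQ bQ] kQ lQ]; first exact: rt.
    rewrite /t' (ct (k, b) (l, b) Q) //= /twist_trans /=.
    by rewrite (coord_ratio_id bQ) exp1rz scale1r.
  move=> k [l c] Q [VQ bQ] kQ [lQ cQ].
  rewrite (cphi k k (l, b) (l, c) Q) //= trans_id // mulmx1 /twist_trans /=.
  rewrite -scalemxAl -scalemxAl trans_id // mul1mx.
  by have := t0 (k, b) l Q VQ; rewrite /psi /= => -> //; rewrite scaler0.
have h1 := has_degree_twist mor_f deg_f irr_X (- m) hF.
have h2 := has_degree_untwist deg_f irr_X hE.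
have := stE _ _ _ (introT andP (conj r0 rn)) hpsi ipsi _ _ h1 h2.
rewrite (_ : 2 * (- m * r) = - (2 * m) * r); last by ring.
rewrite (_ : - (2 * (m * n)) = - (2 * m) * n); last by ring.
by rewrite !slopeD // ltrD2r.
Qed.

End TwistStable.

(** * Sections of the twists *)

Section TrivialBundle.
Variables (R : realType) (N : nat) (X : set (proj R N)).
Hypothesis irr_X : zirreducible X.
Hypothesis smooth_X : forall P, X P -> exists t, local_parameter X P t.

Lemma trivial_trans_regular n :
  mx_regular_on X (X `&` X) (fun=> 1%:M : 'M[R[i]]_n).
Proof. by move=> i j P [XP _]; exact: regular_at_cst. Qed.

Definition trivial_bundle n : bundle X n :=
  @Bundle R N X n unit (fun=> X) (fun _ _ _ => 1%:M) (fun=> zopenT X)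
    (fun P XP => ex_intro _ tt XP) (fun _ _ => @trivial_trans_regular n)
    (fun _ _ _ => erefl) (fun _ _ _ _ _ _ _ => mulmx1 _).

Lemma has_degree_trivial n : has_degree (trivial_bundle n) 0.
Proof.
exists X, (fun _ _ => 1), (fun=> 0); split.
- by split; [exact: zopenT | case: irr_X].
- split=> [i P [XP _]|i j P _ _ _] /=; first exact: regular_at_cst.
  by rewrite det1 mulr1.
(* Even order zero is expressed with a local parameter, which nonsingularity supplies. *)
- move=> [] P XP; have [t lt] := smooth_X XP.
  have h1 : has_ord X P (fun=> 1) 0.
    by apply: has_ord_unit lt _ _; rewrite ?oner_eq0 //; exact: regular_at_cst.
  exists (fun=> 1), (fun=> 1), 0%N, 0%N; split=> //.
  exists X; split=> [||Q _]; [exact: zopenT | by case: irr_X | by rewrite mul1r].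
- by apply: sub_finite_set (finite_set0 _) => P [].
- by rewrite fsbig1.
Qed.

Lemma stable_no_section n (E : bundle X n) d u : stable E -> (1 < n)%N ->
  has_degree E d -> slope n d <= 0 -> section_on (E := E) X u ->
  forall i P, chart i P -> u i P = 0.
Proof.
move=> stE n1 hd d0 [ru cu] i P iP; apply: contrapT => uP.
pose phi (_ : chart_index (trivial_bundle 1)) (j : chart_index E) := u j.
have sub (j : chart_index E) Q : chart j Q -> X Q.
  by move=> h; exact: (zopen_sub (chart_open j) h).
have hphi : bundle_hom phi.
  split=> [k j a b Q [XQ jQ]|k k' j j' Q XQ _ jQ j'Q]; first exact: ru.
  by rewrite mulmx1 /phi; exact: cu.
have iphi : injective_hom phi.
  move=> V t oV [rt ct] t0 [] Q VQ XQ; apply: contrapT => tQ.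
  have [a ua] : exists a, u i P a 0 != 0.
    apply: contrapT => /forallNP h; apply: uP; apply/matrixP => a b.
    by rewrite (ord1 b) mxE; apply/eqP/negPn/negP; exact: h.
  have tQ0 : t tt Q 0 0 != 0.
    apply/eqP => e; apply: tQ; apply/matrixP => b c.
    by rewrite (ord1 b) (ord1 c) mxE.
  have o1 : zopen X (chart i `&` [set Q | u i Q a 0 != 0]).
    apply: zopen_neq0; first exact: chart_open.
    by move=> T iT; apply: ru; split=> //; exact: sub iT.
  have o2 : zopen X (V `&` [set Q | t tt Q 0 0 != 0]).
    by apply: zopen_neq0 => // T VT; apply: rt; split=> //; exact: zopen_sub oV _ VT.
  (* By irreducibility there is a point where [t] and the coordinate [a] of [u] are both nonzero;
     their product cannot vanish there. *)
  have [|| T [[iT uT] [VT tT]]] := zopen_meet irr_X o1 o2; [by exists P | by exists Q |].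
  have := t0 tt i T VT (sub _ _ iT) iT => /matrixP/(_ a 0).
  rewrite /phi !mxE big_ord1 => /eqP; rewrite mulf_eq0.
  by rewrite (negPf uT) (negPf tT).
have := stE _ _ _ (n1 : (0 < 1 < n)%N) hphi iphi _ _ (has_degree_trivial 1) hd.
by rewrite {1}/slope mul0r ltNge d0.
Qed.

End TrivialBundle.

(** * The base-point-free pencil and sections of the twists *)

Section TwistSections.
Variables (R : realType) (N : nat) (X : set (proj R N)).
Variable f : proj R N -> proj R 1.
Hypothesis mor_f : morphism_to_proj X f.
Variables (n : nat) (E : bundle X n).
Hypothesis no_section : forall u, section_on (E := twist mor_f E (-1)) X u ->
  forall ib P, chart ib P -> u ib P = 0.

Local Notation v b P := (rep (f P) 0 b).

(* Base-point-free pencil trick: with [x = v 0] and [y = v 1], the relation gives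
   [x ^ M * w_M = - y * (...)], so [w_M / y] is regular also where [y = 0]. *)
Lemma pencil_relation M (w : nat -> chart_index E -> proj R N -> 'cV[R[i]]_n) :
  (forall a, (a <= M)%N -> section_on X (w a)) ->
  (forall i P, chart i P ->
     \sum_(a < M.+1) (v 0 P ^+ a * v 1 P ^+ (M - a)) *: w a i P = 0) ->
  forall a i P, (a <= M)%N -> chart i P -> w a i P = 0.
Proof.
have sub (i : chart_index E) Q : chart i Q -> X Q.
  by move=> h; exact: (zopen_sub (chart_open i) h).
elim: M w => [|M IH] w sw rel a i P aM iP.
  move: aM; rewrite leqn0 => /eqP ->; have := rel _ _ iP.
  by rewrite big_ord1 !expr0 mulr1 scale1r.
(* The relation without its last term, divided by y; [S = 0] is the relation of degree [M] that
   feeds the induction. *)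
pose S j Q := \sum_(a < M.+1) (v 0 Q ^+ a * v 1 Q ^+ (M - a)) *: w a j Q.
have rel' j Q : chart j Q -> v 0 Q ^+ M.+1 *: w M.+1 j Q = - (v 1 Q *: S j Q).
  move=> jQ; apply/eqP; rewrite -addr_eq0 addrC; apply/eqP; rewrite -[RHS](rel _ _ jQ).
  rewrite [RHS]big_ord_recr /= subnn expr0 mulr1; congr (_ + _).
  rewrite scaler_sumr; apply: eq_bigr => b _; rewrite scalerA mulrCA -exprS subSn //.
  by rewrite -ltnS.
(* This is w_(M+1) / y as a section of E(-H), hence the factor x_b in chart b. The second branch is
   the expression for it that the relation yields where x is nonzero. *)
pose u (jb : chart_index E * bool) Q := if v 1 Q != 0
  then (v (coord_index jb.2) Q / v 1 Q) *: w M.+1 jb.1 Q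
  else - (v (coord_index jb.2) Q / v 0 Q ^+ M.+1) *: S jb.1 Q.
have u0 jb Q : chart jb.1 Q -> v 0 Q != 0 ->
    u jb Q = - (v (coord_index jb.2) Q / v 0 Q ^+ M.+1) *: S jb.1 Q.
  move=> jQ v0; rewrite /u; case: ifP => // v1.
  have v0M : v 0 Q ^+ M.+1 != 0 by rewrite expf_neq0.
  apply: (scalerI v0M); apply: (scalerI v1); rewrite !scalerA.
  set vb := v (coord_index jb.2) Q; move: (rel' _ _ jQ); move: v0M.
  set z := v 0 Q ^+ _ => z0 ez.
  have -> : v 1 Q * z * (vb / v 1 Q) = vb * z by field.
  have -> : v 1 Q * z * - (vb / z) = - (vb * v 1 Q) by field.
  by rewrite -scalerA ez scalerN scalerA scaleNr.
have su : section_on (E := twist mor_f E (-1)) X u.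
  split=> [[j b] k l Q [XQ [/= jQ bQ]]|[j b] [k c] Q XQ [/= jQ bQ] [/= kQ cQ]].
    have [v1|v1] := eqVneq (v 1 Q) 0; last first.
      apply: (regular_at_germ (f := fun T =>
        coord_ratio f 1 (coord_index b) T * w M.+1 j T k l)).
        exists (coord_open X f 1); split=> //; first exact: zopen_coord.
        by move=> T [_ /= T1]; rewrite /u T1 mxE.
      apply: regular_atM; first by apply: coord_ratio_regular.
      by have [+ _] := sw _ (leqnn _); apply.
    have v0 := rep_coord0_neq0 v1.
    (* Each coefficient has degree 0 in the coordinates, so where x is nonzero it is a power of y /
       x times x_b / x. *)
    apply: (regular_at_germ (f := fun T => (-1) * \sum_(a < M.+1)
        (coord_ratio f 0 1 T ^+ (M - a) * coord_ratio f 0 (coord_index b) T) * w a j T k l)).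
      exists (chart j `&` coord_open X f 0); split=> //.
        by apply: zopenI; [exact: chart_open | exact: zopen_coord].
      move=> T [jT [_ /= T0]]; rewrite u0 //= mxE summxE mulN1r mulNr mulr_sumr.
      congr (- _); apply: eq_bigr => e _; rewrite mxE [RHS]mulrA.
      congr (_ * w e j T k l); rewrite /coord_ratio expr_div_n.
      have -> : v 0 T ^+ M.+1 = v 0 T * (v 0 T ^+ e * v 0 T ^+ (M - e)).
        by rewrite -exprD subnKC ?exprS // -ltnS.
      have x0 : v 0 T ^+ e != 0 by rewrite expf_neq0.
      have y0 : v 0 T ^+ (M - e) != 0 by rewrite expf_neq0.
      by field; rewrite y0 x0 T0.
    have Q0 : coord_open X f 0 Q by [].
    apply: regular_atM; first exact: regular_at_cst.
    apply: regular_at_sum => // e _; apply: regular_atM.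
      apply: regular_atM; last exact: coord_ratio_regular.
      by apply: regular_atX; exact: coord_ratio_regular.
    by have [+ _] := sw e (leqW (ltn_ord e : (e <= M)%N)); apply.
  have tr e : (e <= M.+1)%N -> w e j Q = trans j k Q *m w e k Q.
    by move=> /sw[_]; apply.
  rewrite /= /twist_trans /= exprN1 /coord_ratio invf_div /u /=.
  have c0 : v (coord_index c) Q != 0 by case: cQ.
  case: ifP => v1.
    rewrite tr // -scalemxAl -scalemxAr scalerA; congr (_ *: _).
    by rewrite mulrA divfK.
  have -> : S j Q = trans j k Q *m S k Q.
    rewrite mulmx_sumr; apply: eq_bigr => e _; rewrite -scalemxAr tr //.
    by rewrite leqW // -ltnS.
  rewrite -scalemxAl -scalemxAr scalerA; congr (_ *: _).
  by rewrite mulrN mulrA divfK.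
(* Where y = 0 the vanishing of [u] gives [S], and the relation then gives w_(M+1); elsewhere the
   two come in the opposite order. *)
have uz j Q : chart j Q -> w M.+1 j Q = 0 /\ S j Q = 0.
  move=> jQ; have XQ := sub _ _ jQ; have [b bQ] := coord_index_cover f XQ.
  have b0 : v (coord_index b) Q != 0 by case: bQ.
  have := no_section su (conj jQ bQ : chart (b := twist mor_f E (-1)) (j, b) Q).
  have [v1|v1] := eqVneq (v 1 Q) 0.
    have v0 := rep_coord0_neq0 v1; have v0M : v 0 Q ^+ M.+1 != 0 by rewrite expf_neq0.
    rewrite u0 //= => /eqP; rewrite scaler_eq0 oppr_eq0 mulf_eq0 invr_eq0.
    rewrite (negPf b0) (negPf v0M) /= => /eqP S0; split=> //.
    have /eqP := rel' _ _ jQ.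
    by rewrite S0 scaler0 oppr0 scaler_eq0 (negPf v0M) => /eqP.
  rewrite /u v1 /= => /eqP; rewrite scaler_eq0 mulf_eq0 invr_eq0.
  rewrite (negPf b0) (negPf v1) /= => /eqP w0; split=> //.
  have /eqP := rel' _ _ jQ.
  by rewrite w0 scaler0 eq_sym oppr_eq0 scaler_eq0 (negPf v1) => /eqP.
move: aM; rewrite leq_eqVlt => /predU1P[->|]; first by have [] := uz _ _ iP.
rewrite ltnS => aM; apply: (IH w) => //.
  by move=> e eM; apply: sw; exact: leqW.
by move=> j Q /uz[].
Qed.

Lemma h0_ge_family (I : finType) n' (F : bundle X n')
    (t : I -> chart_index F -> proj R N -> 'cV[R[i]]_n') (k : int) :
  (forall l, section_on X (t l)) ->
  (forall c : I -> R[i],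
    (forall i P, chart i P -> \sum_l c l *: t l i P = 0) -> forall l, c l = 0) ->
  k <= #|I|%:Z -> h0_ge F k.
Proof.
move=> st ft kI; exists #|I| => //; exists (fun l => t (enum_val l)); split=> // c h l.
rewrite -(enum_valK l); apply: (ft (fun x => c (enum_rank x))) => i P iP.
rewrite -[RHS](h _ _ iP) (big_enum_val (A := I)) /=.
by apply: eq_bigr => x _; rewrite enum_valK.
Qed.

Lemma h0_ge_twist (M : nat) (k : int) :
  h0_ge E k -> h0_ge (twist mor_f E M%:Z) (M.+1%:Z * k).
Proof.
move=> [m km [t [st ft]]].
pose tt (la : 'I_m * 'I_M.+1) (ib : chart_index E * bool) Q :=
  (coord_ratio f (coord_index ib.2) 0 Q ^+ la.2 *
   coord_ratio f (coord_index ib.2) 1 Q ^+ (M - la.2)) *: t la.1 ib.1 Q.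
apply: (h0_ge_family (F := twist mor_f E M%:Z) (t := tt)).
- move=> [l a]; have [rt ct] := st l.
  split=> [[i b] e e' P [XP [/= iP bP]]|[i b] [j c] P XP [/= iP bP] [/= jP cP]].
    rewrite /tt /=; under eq_fun do rewrite mxE.
    apply: regular_atM; last exact: rt.
    by apply: regular_atM; apply: regular_atX; exact: coord_ratio_regular.
  rewrite /tt /twist_trans /= (ct _ _ _ XP iP jP) -scalemxAl -scalemxAr scalerA.
  congr (_ *: _); rewrite -(coord_ratioM (coord_index b) 0 cP).
  rewrite -(coord_ratioM (coord_index b) 1 cP).
  have e (x y z : R[i]) :
      (x * y) ^+ a * (x * z) ^+ (M - a) = x ^+ M * (y ^+ a * z ^+ (M - a)).
    by rewrite !exprMn mulrACA -exprD subnKC // -ltnS.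
  exact: e.
- move=> c h [l a].
  (* Terms with the same monomial are collected, which gives a relation of the shape required by
     [pencil_relation]; [inord] only serves its indexing by naturals. *)
  pose w (a : nat) i Q := \sum_l c (l, inord a) *: t l i Q.
  have w0 : forall a i P, (a <= M)%N -> chart i P -> w a i P = 0.
    apply: pencil_relation => [e _|i P iP].
      split=> [i p q P XiP|i j P XP iP jP].
        under eq_fun do rewrite summxE; apply: regular_at_sum; first by case: XiP.
        move=> l' _; under eq_fun do rewrite mxE; apply: regular_atM.
          by apply: regular_at_cst; case: XiP.
        by have [+ _] := st l'; apply.
      rewrite /w mulmx_sumr; apply: eq_bigr => l' _; rewrite -scalemxAr.
      by have [_ <-] := st l'.
    have XP := zopen_sub (chart_open i) iP.
    have [b bP] := coord_index_cover f XP.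
    have b0 : v (coord_index b) P != 0 by case: bP.
    have eq2 : \sum_l c l *: tt l (i, b) P =
        \sum_l \sum_a c (l, a) *: tt (l, a) (i, b) P.
      by rewrite pair_big; apply: eq_bigr => -[].
    have := h (i, b) P (conj iP bP); rewrite eq2 exchange_big /=.
    (* Multiplying by x_b^M turns the coordinate ratios back into homogeneous coordinates. *)
    move=> /(congr1 (fun z => v (coord_index b) P ^+ M *: z)).
    rewrite /= scaler0 => h0; apply: etrans h0; rewrite scaler_sumr.
    apply: eq_bigr => e _; rewrite /w !scaler_sumr; apply: eq_bigr => l' _.
    rewrite inord_val /tt /= !scalerA; congr (_ *: _).
    rewrite /coord_ratio !expr_div_n.
    have -> : v (coord_index b) P ^+ M =
        v (coord_index b) P ^+ e * v (coord_index b) P ^+ (M - e).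
      by rewrite -exprD subnKC // -ltnS.
    have x0 : v (coord_index b) P ^+ e != 0 by rewrite expf_neq0.
    have y0 : v (coord_index b) P ^+ (M - e) != 0 by rewrite expf_neq0.
    by field; rewrite x0 y0.
  rewrite -(inord_val a); apply: (ft (fun l => c (l, inord a))) => i P iP.
  by apply: (w0 a) => //; rewrite -ltnS.
- by rewrite card_prod !card_ord PoszM mulrC ler_wpM2r.
Qed.

End TwistSections.

(** * The slope regions and the conclusion *)

Lemma regions_x1_le2 g x : (BGN g `|` regionM g) x -> x.1 <= 2.
Proof.
move=> [[/= /andP[/andP[_ h] _] _]|[/andP[/andP[_ h] _]|/andP[/eqP-> _]]] //.
  exact: le_trans h _.
exact: ltW.
Qed.

(* In rank one the slope and [k] are integers; [(1, 1)] would be the only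
   candidate, and it is removed from [BGN]. *)
Lemma regions_rank1 g x (d k : int) : (0 < g)%N -> (BGN g `|` regionM g) x ->
  d%:~R = x.1 -> k%:~R = x.2 -> False.
Proof.
case: x => x1 x2 g0 reg /= dx kx; move: reg; rewrite -{}dx -{}kx.
move=> [[/= /andP[/andP[d0 d1] /andP[k0 k1]] nx]|]; last first.
  move=> [/= /andP[/andP[]]|/= /andP[_ /andP[]]].
    by rewrite (ltr_int _ 1) (ltr_int _ d 2) => d1 d2; lia.
  by rewrite (ltr_int _ 0) (ltr_int _ k 1) => k0 k1; lia.
have d_eq : d = 1.
  by move: d0 d1; rewrite (ltr_int _ 0) (ler_int _ d 1) => d0 d1; lia.
have k_eq : k = 1.
  move: k0 k1; rewrite d_eq addrAC subrr add0r mulVf ?pnatr_eq0 -?lt0n //.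
  by rewrite (ltr_int _ 0) (ler_int _ k 1) => k0 k1; lia.
by apply: nx; rewrite d_eq k_eq.
Qed.

Theorem theorem6p1 (R : realType) (N g : nat) (X : set (proj R N))
    (x : rat * rat) (s : int) :
  nonsingular_projective_curve X -> hyperelliptic X ->
  has_genus X g -> (3 <= g)%N ->
  (BGN g `|` regionM g) x -> 1 <= s <= g%:Z ->
  forall n : nat, (0 < n)%N -> is_BN X n x -> is_BN X n (affT (2 * s - 2) s x).
Proof.
move=> [_ irr_X _ smooth_X] [f [mor_f deg_f]] _ g3 reg /andP[s1 _] n n0.
move=> [d [k [hd hk [E [stE degE h0E]]]]].
(* With M = s - 1 there are s monomials of degree M in x and y, and twisting by MH adds 2s - 2 to
   the slope. *)
have [M ->] : exists M : nat, s = M.+1%:Z by exists `|s|.-1%N; lia.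
have n1 : (1 < n)%N.
  rewrite ltn_neqAle n0 andbT; apply/eqP => n1.
  apply: (regions_rank1 (ltn_trans (isT : 0 < 2)%N g3) reg (d := d) (k := k)).
    by rewrite hd -n1 mul1r.
  by rewrite hk -n1 mul1r.
have no_section u : section_on (E := twist mor_f E (-1)) X u ->
    forall ib P, chart ib P -> u ib P = 0.
  apply: (stable_no_section irr_X smooth_X _ n1
    (has_degree_twist mor_f deg_f irr_X (-1) degE)).
    exact: twist_stable.
  (* The slope of E(-H) is [x.1 - 2]. *)
  rewrite mulrA slopeD // /slope hd mulrAC divff ?mul1r; last first.
    by rewrite pnatr_eq0 -lt0n.
  by rewrite mulrN1 rmorphN /= subr_le0; exact: regions_x1_le2 reg.
exists (d + 2 * (M%:Z * n%:Z)), (M.+1%:Z * k); split.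
- rewrite /affT /= rmorphD rmorphM rmorphM /= hd.
  by rewrite -pmulrn intS; ring.
- by rewrite /affT /= rmorphM /= hk mulrCA.
- exists (twist mor_f E M%:Z); split.
  + exact: twist_stable.
  + exact: has_degree_twist.
  + exact: h0_ge_twist.
Qed.
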